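(* Consider the wireless scheduling problem in the SINR model (defined in the context). There is an ack-only distributed algorithm that is an $O(\log n)$-approximation for the scheduling problem (that is, on every set $L$ of $n$ links, all links successfully transmit within $O(T(L)\log n)$ slots with high probability, where $T(L)$ is the scheduling number of $L$) in each of the following cases: (i) uni-directional links with the uniform power assignment; (ii) uni-directional links with the linear power assignment; (iii) bi-directional links with any length-monotone sub-linear power assignment. If one additionally assumes free (or cheap) acknowledgements, the same $O(\log n)$-approximation holds for every length-monotone sub-linear power assignment for uni-directional links.
   Context: A link $\ell_v$ is a pair (sender $s_v$, receiver $r_v$) of points in a metric space with distance $d$; its length is also denoted $\ell_v=d(s_v,r_v)$. For links $\ell_w,\ell_v$ (uni-directional model) let $d_{wv}=d(s_w,r_v)$; in the bi-directional model instead $d_{wv}=\min(d(s_w,r_v),d(s_v,r_w),d(s_w,s_v),d(r_w,r_v))$. Each link $\ell_v$ transmits with power $P_v$. Fixed parameters: path loss exponent $\alpha>0$, threshold $\beta\ge 1$, noise $N\ge 0$. A set $S$ of simultaneously transmitting links is feasible if for every $\ell_v\in S$: $\frac{P_v/\ell_v^\alpha}{\sum_{\ell_w\in S\setminus\{\ell_v\}}P_w/d_{wv}^\alpha+N}\ge\beta$; a link succeeds in a slot iff this inequality holds for it with respect to the set of links transmitting in that slot. The scheduling problem: given a set $L$ of $n$ links, partition it into the minimum number of feasible sets; this minimum is the scheduling number $T(L)$. A power assignment is length-monotone if $P_v\ge P_w$ whenever $\ell_v\ge \ell_w$, and sub-linear if $P_v/\ell_v^\alpha\le P_w/\ell_w^\alpha$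 whenever $\ell_v\ge\ell_w$; uniform power means all $P_v$ equal, linear power means $P_v$ proportional to $\ell_v^\alpha$. Distributed setting: senders and receivers know a rough estimate of $n$, have synchronized clocks and must use the given fixed power assignment; senders transmit repeatedly until they learn of their success, and the only external information senders receive is an acknowledgement from their receiver after a successful transmission; an algorithm operating under these constraints is called ack-only. Without free acknowledgements, the acknowledgements must themselves be realized by the algorithm as transmissions from each receiver to its sender (the reversed, ''dual'' link), subject to the same SINR success condition; with free acknowledgements they need not be realized. *)

(* Defs.v *)
From mathcomp Require Import all_boot all_order all_algebra.
From mathcomp Require Import reals ereal topology normedtype exp.

Set Implicit Arguments.
Unset Strict Implicit.
Unset Printing Implicit Defensive.

Import Order.TTheory GRing.Theory Num.Theory.
Local Open Scope ring_scope.

Section Links.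
Variables (R : realType) (X : metricType R).

(* (sender, receiver) *)
Definition link := (X * X)%type.

Definition link_length (l : link) : R := mdist l.1 l.2.

Definition dual_link (l : link) : link := (l.2, l.1).

End Links.

Variant link_model := Unidirectional | Bidirectional.

(* d_{wv}: distance at which the interference of link w is felt by link v *)
Definition link_dist (R : realType) (X : metricType R) (m : link_model)
    (w v : link X) : R :=
  match m with
  | Unidirectional => mdist w.1 v.2
  | Bidirectional =>
      Num.min (Num.min (mdist w.1 v.2) (mdist v.1 w.2))
              (Num.min (mdist w.1 v.1) (mdist w.2 v.2))
  end.

Section SINR.
Variables (R : realType) (alpha beta noise : R) (m : link_model).
Variables (X : metricType R) (I : finType) (L : I -> link X) (P : I -> R).

(* Extended reals: [0^-1 = +oo], so a transmission at distance 0 interferes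
   infinitely, and the ratio is [+oo] when there is neither interference nor
   noise. *)
Definition received_power (p d : R) : \bar R := (p%:E / (d `^ alpha)%:E)%E.

Definition sinr (S : {set I}) (v : I) : \bar R :=
  (received_power (P v) (link_length (L v)) /
   (\sum_(w in S :\ v) received_power (P w) (link_dist m (L w) (L v))
    + noise%:E))%E.

Definition succeeds (S : {set I}) (v : I) : bool :=
  (v \in S) && (beta%:E <= sinr S v)%E.

Definition feasible (S : {set I}) : bool := [forall v in S, succeeds S v].

Definition is_schedule (Q : {set {set I}}) : Prop :=
  finset.partition Q [set: I] /\ (forall S, S \in Q -> feasible S).

(* No number [T] qualifies when some link is infeasible even alone. *)
Definition is_scheduling_number (T : nat) : Prop :=
  (exists2 Q, is_schedule Q & #|Q| = T) /\
  (forall Q, is_schedule Q -> (T <= #|Q|)%N).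

End SINR.

Section PowerAssignments.
Variables (R : realType) (alpha : R).

(* A property of the powers [P] of a family of links of lengths [len] *)
Definition power_class := forall I : finType, (I -> R) -> (I -> R) -> Prop.

Definition uniform_power : power_class :=
  fun I len P => forall v w, P v = P w.

Definition linear_power : power_class :=
  fun I len P => exists c, forall v, P v = c * len v `^ alpha.

Definition length_monotone : power_class :=
  fun I len P => forall v w, len w <= len v -> P w <= P v.

Definition sub_linear : power_class :=
  fun I len P => forall v w, len w <= len v ->
    P v / len v `^ alpha <= P w / len w `^ alpha.

Definition monotone_sub_linear : power_class :=
  fun I len P => length_monotone len P /\ sub_linear len P.

End PowerAssignments.

(* A strategy common to all nodes, given by the probability of transmitting in
   the next slot. The first argument is the estimate of the number of links,
   the second one the local history (one item per past slot, so that its size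
   is the clock): for a sender that has not been acknowledged yet, whether it
   transmitted; for a receiver, whether it received its sender's message and
   whether it transmitted an acknowledgement. *)
Record ack_only_algorithm (R : realType) := AckOnlyAlgorithm {
  send_prob : nat -> seq bool -> R;
  reply_prob : nat -> seq (bool * bool) -> R;
  send_prob01 : forall nhat h, 0 <= send_prob nhat h <= 1;
  reply_prob01 : forall nhat h, 0 <= reply_prob nhat h <= 1
}.

(* [RealizedAcks]: acknowledgements are transmissions on the dual links.
   [CheapAcks k]: a sender learns of its success at once, without interference,
   at a cost of [k] additional slots per slot of transmissions; [CheapAcks 0]
   are free acknowledgements. *)
Variant ack_model := RealizedAcks | CheapAcks of nat.

Definition rounds (a : ack_model) (slots : nat) : nat :=
  match a with
  | RealizedAcks => slots
  | CheapAcks k => (slots %/ k.+1)%N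
  end.

Section Execution.
Variables (R : realType) (alpha beta noise : R) (m : link_model).
Variables (a : ack_model) (A : ack_only_algorithm R) (nhat : nat).
Variables (X : metricType R) (I : finType) (L : I -> link X) (P : I -> R).

(* [(v, false)] is the link [v] and [(v, true)] its dual. A slot is described
   by the set of all transmissions taking place in it. *)
Definition node_link (e : I * bool) : link X :=
  if e.2 then dual_link (L e.1) else L e.1.

Definition node_power (e : I * bool) : R := P e.1.

Notation slot := {set I * bool}.

Definition delivered (e : I * bool) (S : slot) : bool :=
  succeeds alpha beta noise m node_link node_power S e.

Definition received (v : I) (h : seq slot) : bool :=
  has (delivered (v, false)) h.

Definition acknowledged (v : I) (h : seq slot) : bool :=
  match a with
  | RealizedAcks => has (delivered (v, true)) h
  | CheapAcks _ => received v h
  end.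

Definition sender_view (v : I) (h : seq slot) : seq bool :=
  [seq (v, false) \in U | U : slot <- h].

Definition receiver_view (v : I) (h : seq slot) : seq (bool * bool) :=
  [seq (delivered (v, false) U, (v, true) \in U) | U : slot <- h].

(* Senders fall silent once acknowledged; receivers never acknowledge a message
   they have not received. *)
Definition transmit_prob (h : seq slot) (e : I * bool) : R :=
  let: (v, is_dual) := e in
  if ~~ is_dual then
    if acknowledged v h then 0 else send_prob A nhat (sender_view v h)
  else
    match a with
    | RealizedAcks =>
        if received v h then reply_prob A nhat (receiver_view v h) else 0
    | CheapAcks _ => 0
    end.

(* Given the past, the nodes draw their decisions independently. *)
Definition slot_prob (h : seq slot) (S : slot) : R :=
  \prod_e (if e \in S then transmit_prob h e else 1 - transmit_prob h e).

Definition execution_prob (t : nat) (x : t.-tuple slot) : R :=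
  \prod_(i < t) slot_prob (take i x) (tnth x i).

Definition prob (t : nat) (E : pred (seq slot)) : R :=
  \sum_(x : t.-tuple slot | E x) execution_prob x.

Definition completed (h : seq slot) : bool :=
  [forall v, received v h && acknowledged v h].

Definition completion_prob (slots : nat) : R := prob (rounds a slots) completed.

End Execution.

(* Estimates polynomially related to [n], that is, [ln n] is known up to the
   constant factor [kappa] *)
Definition rough_estimate (kappa n nhat : nat) : Prop :=
  (n <= nhat ^ kappa)%N /\ (nhat <= n ^ kappa)%N.

(* With high probability: the failure probability is at most [n ^- c], for an
   arbitrary constant [c] on which the constant [C] may depend. *)
Definition log_approximation (R : realType) (alpha beta noise : R)
    (A : ack_only_algorithm R) (m : link_model) (a : ack_model)
    (pc : power_class R) : Prop :=
  forall kappa c : nat, exists C : R,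
  forall (X : metricType R) (n nhat : nat) (L : 'I_n -> link X) (P : 'I_n -> R)
         (T : nat),
    (1 < n)%N ->
    rough_estimate kappa n nhat ->
    (forall v, 0 < link_length (L v)) ->
    (forall v, 0 < P v) ->
    pc 'I_n (fun v => link_length (L v)) P ->
    is_scheduling_number alpha beta noise m L P T ->
    1 - n%:R ^- c <=
      completion_prob alpha beta noise m a A nhat L P
        (Num.truncn (C * T%:R * ln n%:R)).

(* Main.v *)
Require Import Defs.
From mathcomp Require Import all_boot all_order all_algebra.
From mathcomp Require Import reals.
From mathcomp Require Import ereal topology normedtype exp.
From mathcomp Require Import ring lra.

(* The affectance [a_w(v)] is the interference of [w] at [v], relative to what
   [v] tolerates and capped at [1]; in a feasible set the affectances on each
   link sum to at most [1]. If all links of such a set are longer than [u],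
   their total affectance on [u] is [O(1)]: compare [u] with the shortest link,
   or with the nearest one, of the set. Symmetrically, [u] affects [O(1)] in
   total a set of longer links in which all outgoing affectances are at most
   [2], and by averaging every feasible set has a subset of half its size with
   that property. Hence, if [T] feasible sets cover a set [S] of links, half of
   the links of [S] receive from [S] a total affectance of [O(T |S|)]. For
   uniform and linear power the affectances of the dual links are, inside a
   feasible set, at most [3 ^ alpha] times the primal ones, so the same holds
   for the acknowledgements.

   In every even slot the links not yet acknowledged transmit with probability
   [q], and in the next slot the successful receivers reply. As soon as
   [q <= 1 / O(T)] the expected number of unacknowledged links shrinks by the
   factor [1 - q / 4] in two slots. With [q = 4 mu / (4 mu + j)] in slot [2 j]
   and [mu ~ log nhat], the product of these factors telescopes to a power [mu]
   of the ratio of two times, hence is polynomially small in [n] after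
   [O(T log n)] slots. *)

Set Implicit Arguments.
Unset Strict Implicit.
Unset Printing Implicit Defensive.

Import Order.TTheory GRing.Theory Num.Theory.
Local Open Scope ring_scope.

(** * Affectance *)

Section Affectance.
Variables (R : realType) (alpha beta noise : R) (m : link_model).
Variables (X : metricType R) (I : finType) (L : I -> link X) (P : I -> R).

Local Notation len v := (link_length (L v)).
Local Notation dist w v := (link_dist m (L w) (L v)).

Definition margin (v : I) : R := P v / (beta * len v `^ alpha) - noise.

(* The paper's [min(1, c_v (P_w / P_v) (l_v / d_wv) ^ alpha)], written so that
   it is [1] when [d_wv = 0] and when [v] tolerates no interference. *)
Definition affectance (w v : I) : R :=
  P w / Num.max (P w) (margin v * dist w v `^ alpha).

(** Cross-multiplication survives both degenerate denominators: [J = 0] makes the ratio [+oo], and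
    [J = +oo] makes it [0], which is below [b]. *)
Lemma ratio_ge (s b : R) (J : \bar R) : 0 < s -> 0 < b -> (0 <= J)%E ->
  (b%:E <= s%:E / J)%E = (J <= (s / b)%:E)%E.
Proof.
move=> s0 b0; case: J => [r| |] //; rewrite ?lee_fin => r0.
  rewrite inver; case: eqP => [->|/eqP rn0].
    by rewrite gt0_muley ?lte_fin // leey ler_pdivlMr // mul0r; apply/esym/ltW.
  have rp : 0 < r by rewrite lt_def rn0.
  by rewrite -EFinM !lee_fin ler_pdivlMr // ler_pdivlMr // mulrC.
by rewrite mulr0 leNgt b0.
Qed.

Hypothesis beta1 : 1 <= beta.
Hypothesis noise0 : 0 <= noise.
Hypothesis len_gt0 : forall v, 0 < len v.
Hypothesis P_gt0 : forall v, 0 < P v.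

Lemma dist_ge0 (w v : I) : 0 <= dist w v.
Proof. by case: m; rewrite /= ?le_min ?mdist_ge0. Qed.

Lemma lenX_gt0 (v : I) : 0 < len v `^ alpha.
Proof. exact: powR_gt0. Qed.

(** The left side is [P v / beta - noise * len v ^ alpha], so [1 <= beta] and [0 <= noise] give the
    bound. It says that a transmitter as strong as [P v], as close to the receiver as its own
    sender, exhausts the tolerance of [v]. *)
Lemma margin_lenX (v : I) : margin v * len v `^ alpha <= P v.
Proof.
rewrite /margin invfM mulrA mulrBl divfK ?gt_eqF ?lenX_gt0 //.
have := lenX_gt0 v; have := P_gt0 v.
set x := _ `^ _ => p0 x0.
have : 0 <= noise * x by rewrite mulr_ge0 // ltW.
have : P v / beta <= P v.
  by rewrite ler_pdivrMr ?(lt_le_trans ltr01) // ler_peMr // ltW.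
lra.
Qed.

Lemma received_power_ge0 (w v : I) :
  (0 <= received_power alpha (P w) (dist w v))%E.
Proof. by rewrite mule_ge0 ?inve_ge0 ?lee_fin ?powR_ge0 // ltW. Qed.

Lemma succeedsE (S : {set I}) (v : I) :
  succeeds alpha beta noise m L P S v = (v \in S) &&
  (\sum_(w in S :\ v) received_power alpha (P w) (dist w v)
     <= (margin v)%:E)%E.
Proof.
rewrite /succeeds; congr (_ && _); rewrite /sinr.
set J := (\sum_(_ in _) _)%E.
have J0 : (0 <= J)%E by apply: sume_ge0 => w _; exact: received_power_ge0.
have b0 := lt_le_trans ltr01 beta1.
rewrite /received_power inver gt_eqF ?lenX_gt0 // -EFinM ratio_ge //.
- rewrite -leeBrDr // -EFinB /margin.
  by rewrite (mulrC beta) invfM mulrA.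
- by rewrite divr_gt0 ?lenX_gt0.
- by rewrite adde_ge0 // lee_fin.
Qed.

Lemma affectance_ge0 (w v : I) : 0 <= affectance w v.
Proof. by rewrite divr_ge0 ?le_max ?(ltW (P_gt0 w)). Qed.

Lemma affectance_le1 (w v : I) : affectance w v <= 1.
Proof. by rewrite ler_pdivrMr ?lt_max ?P_gt0 // mul1r le_max lexx. Qed.

Lemma affectance_received (w v : I) : 0 <= margin v ->
  ((affectance w v * margin v)%:E <= received_power alpha (P w) (dist w v))%E.
Proof.
move=> g0; rewrite /received_power /affectance; set x := _ `^ _.
have x0 : 0 <= x by exact: powR_ge0.
rewrite inver; case: eqP => [_|/eqP xn0].
  by rewrite gt0_muley ?lte_fin // leey.
have xp : 0 < x by rewrite lt_def xn0.
rewrite -EFinM lee_fin ler_pdivlMr // -[leLHS]mulrA mulrAC.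
by rewrite ler_pdivrMr ?lt_max ?P_gt0 // ler_pM2l // le_max lexx orbT.
Qed.

Lemma received_affectance (w v : I) : affectance w v < 1 -> 0 <= margin v ->
  received_power alpha (P w) (dist w v) = (affectance w v * margin v)%:E.
Proof.
rewrite ltr_pdivrMr ?lt_max ?P_gt0 // mul1r lt_max ltxx /= => Plt g0.
rewrite /received_power /affectance max_r ?(ltW Plt) //; set x := _ `^ _ in Plt *.
have gx0 : 0 < margin v * x by exact: lt_trans Plt.
have xn0 : x != 0 by apply: contraTneq gx0 => ->; rewrite mulr0 ltxx.
have gn0 : margin v != 0 by apply: contraTneq gx0 => ->; rewrite mul0r ltxx.
rewrite inver (negPf xn0) -EFinM; congr (_%:E).
by rewrite invfM mulrA mulrAC divfK.
Qed.

(** A sum strictly below [1] keeps every single affectance below the cap, and there it is the exact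
    ratio of received power to margin. *)
Lemma succeeds_of_affectance (S : {set I}) (v : I) : v \in S ->
  0 <= margin v -> \sum_(w in S :\ v) affectance w v < 1 ->
  succeeds alpha beta noise m L P S v.
Proof.
move=> vS g0 lt1; rewrite succeedsE vS /=.
rewrite (eq_bigr (fun w => (affectance w v * margin v)%:E)) => [|w wS].
  by rewrite sumEFin lee_fin -mulr_suml ler_piMl // ltW.
apply: received_affectance => //; apply: le_lt_trans lt1.
rewrite (bigD1 w) //= lerDl sumr_ge0 // => *; exact: affectance_ge0.
Qed.

Lemma succeeds_margin (S : {set I}) (v : I) :
  succeeds alpha beta noise m L P S v -> 0 <= margin v.
Proof.
rewrite succeedsE => /andP[_]; rewrite -lee_fin; apply: le_trans.
by apply: sume_ge0 => w _; exact: received_power_ge0.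
Qed.

Lemma succeeds_received (S : {set I}) (v w : I) :
    succeeds alpha beta noise m L P S v -> w \in S -> w != v ->
  P w <= margin v * dist w v `^ alpha.
Proof.
rewrite succeedsE => /andP[_] le_sum wS wv.
have : (received_power alpha (P w) (dist w v) <= (margin v)%:E)%E.
  apply: le_trans le_sum; rewrite (bigD1 w) /= ?in_setD1 ?wv //.
  by rewrite leeDl // sume_ge0 // => *; exact: received_power_ge0.
rewrite /received_power inver; case: eqP => [_|/eqP xn0].
  by rewrite gt0_muley ?lte_fin.
have xp : 0 < dist w v `^ alpha by rewrite lt_def xn0 powR_ge0.
by rewrite -EFinM lee_fin ler_pdivrMr.
Qed.

Lemma succeeds_affectance (S : {set I}) (v : I) :
  succeeds alpha beta noise m L P S v -> \sum_(w in S :\ v) affectance w v <= 1.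
Proof.
move=> sv; have g0 := succeeds_margin sv.
have [g_eq0|gn0] := eqVneq (margin v) 0.
  (* With zero margin one cannot divide by it, but then [S :\ v] is empty: any other transmitter
     would have power at most [0]. *)
  rewrite big_pred0 // => w; apply/negbTE/negP; rewrite in_setD1 => /andP[wv wS].
  have := succeeds_received sv wS wv.
  by rewrite g_eq0 mul0r leNgt P_gt0.
have gp : 0 < margin v by rewrite lt_def gn0.
move: sv; rewrite succeedsE => /andP[_ le_sum].
rewrite -(ler_pM2r gp) mul1r mulr_suml -lee_fin -sumEFin.
by apply: le_trans le_sum; apply: lee_sum => w _; exact: affectance_received.
Qed.

End Affectance.

(** * Affectance between a link and longer links *)

Section LinkDistance.
Variables (R : realType) (X : metricType R).
Implicit Types u v w : link X.

(** The boolean index lets the four distances in the bi-directional minimum be handled uniformly. *)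
Definition endpoint v (b : bool) : X := if b then v.2 else v.1.

Lemma mdist_endpoints v (b c : bool) :
  mdist (endpoint v b) (endpoint v c) <= link_length v.
Proof.
by case: b; case: c; rewrite /link_length /= ?mdistxx ?mdist_ge0 // metric_sym.
Qed.

Lemma bidirectional_le w v (b c : bool) :
  link_dist Bidirectional w v <= mdist (endpoint w b) (endpoint v c).
Proof.
by case: b; case: c; rewrite /= !ge_min ?lexx ?orbT // (metric_sym w.2) lexx !orbT.
Qed.

Lemma bidirectionalP w v : exists b c,
  link_dist Bidirectional w v = mdist (endpoint w b) (endpoint v c).
Proof.
rewrite /link_dist /Num.min; case: ifP => _; case: ifP => _.
- by exists false, true.
- by exists true, false; rewrite metric_sym.
- by exists false, false.
- by exists true, true.
Qed.

Lemma bidirectional_sym w v :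
  link_dist Bidirectional w v = link_dist Bidirectional v w.
Proof.
apply/eqP; rewrite eq_le; apply/andP; split.
  have [b [c ->]] := bidirectionalP v w.
  by rewrite metric_sym bidirectional_le.
have [b [c ->]] := bidirectionalP w v.
by rewrite metric_sym bidirectional_le.
Qed.

Lemma bidirectional_dual w v : link_dist Bidirectional (dual_link w) (dual_link v)
  = link_dist Bidirectional w v.
Proof.
rewrite /= minC (metric_sym v.2) (metric_sym w.2 v.1) minC.
by congr Num.min; rewrite minC.
Qed.

(** The minima for [v] and for [w] may be attained at different endpoints of [u]; crossing [u] costs
    its length. *)
Lemma bidirectional_triangle u v w : link_dist Bidirectional v w <=
  link_dist Bidirectional v u + (link_dist Bidirectional w u + link_length u).
Proof.
have [b [c ->]] := bidirectionalP v u; have [b' [c' ->]] := bidirectionalP w u.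
apply: le_trans (bidirectional_le v w b b') _.
apply: le_trans (metric_triangle _ (endpoint u c) _) _; rewrite lerD2l.
apply: le_trans (metric_triangle _ (endpoint u c') _) _; rewrite addrC lerD //.
  by rewrite metric_sym.
exact: mdist_endpoints.
Qed.

(** [k w] is the cost of going on from [u] to [w]. In the bi-directional case it includes the length
    of [u], which [link_length u <= link_length v] absorbs in the first bound. *)
Lemma into_detour m u : exists k : link X -> R,
  (forall v, link_length u <= link_length v ->
     k v <= link_dist m v u + link_length v) /\
  (forall v w, link_dist m v w <= link_dist m v u + k w).
Proof.
case: m.
  exists (fun v => mdist u.2 v.2); split => [v _|v w]; last exact: metric_triangle.
  by rewrite /link_length /= (metric_sym v.1 u.2) metric_triangle.
exists (fun v => link_dist Bidirectional v u + link_length u).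
by split => [v le_uv|v w]; [rewrite lerD2l|exact: bidirectional_triangle].
Qed.

Lemma out_detour m u : exists k : link X -> R,
  (forall v, link_length u <= link_length v ->
     k v <= link_dist m u v + link_length v) /\
  (forall v w, link_dist m w v <= link_dist m u v + k w).
Proof.
case: m.
  exists (fun v => mdist v.1 u.1); split => [v _|v w].
    by rewrite addrC /link_length /= (metric_sym u.1) metric_triangle.
  by rewrite addrC metric_triangle.
have [k [k1 k2]] := into_detour Bidirectional u.
exists k; split=> [v|v w]; first by rewrite bidirectional_sym; exact: k1.
by rewrite bidirectional_sym (bidirectional_sym u); exact: k2.
Qed.

End LinkDistance.

(* Split [S] into the [v] with [D v <= len v] and the others; compare with the
   shortest [v0] of the first part and with the [v0] of minimal [kappa] in the
   second part. *)
Lemma sum_comparison (R : realType) (I : finType) (S : {set I}) (f : I -> R)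
    (g d : I -> I -> R) (len D kappa : I -> R) (K M : R) :
    0 <= K ->
    (forall v, f v <= 1) ->
    (forall v0 v, 0 <= g v0 v) ->
    (forall v0, v0 \in S -> \sum_(v in S :\ v0) g v0 v <= M) ->
    (forall v0 v, v0 \in S -> v \in S -> 0 <= D v -> d v0 v <= 3 * D v ->
       f v <= K * g v0 v) ->
    (forall v0 v, v0 \in S -> v \in S -> len v0 <= len v ->
       d v0 v <= 4 * len v0 -> 1 <= K * g v0 v) ->
    (forall v, 0 < len v) ->
    (forall v, v \in S -> kappa v <= D v + len v) ->
    (forall v0 v, v0 \in S -> v \in S -> d v0 v <= D v + kappa v0) ->
  0 <= M -> \sum_(v in S) f v <= 2 * (1 + K * M).
Proof.
move=> K0 f1 g0 gM far near len0 kD dk M0.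
(* The term of the reference [v0] is at most [1]; all others are charged to [g v0], whose sum is at
   most [M]. *)
have part (p : pred I) v0 : v0 \in S -> p v0 ->
    (forall v, v \in S -> p v -> f v <= K * g v0 v) ->
    \sum_(v in S | p v) f v <= 1 + K * M.
  move=> v0S pv0 fg; rewrite (bigD1 v0) /= ?v0S // lerD //.
  apply: le_trans (ler_wpM2l K0 (gM _ v0S)); rewrite mulr_sumr.
  rewrite [leRHS](bigID p) /= -[leLHS]addr0 lerD //; last first.
    by rewrite sumr_ge0 // => v _; rewrite mulr_ge0.
  rewrite (eq_bigl (fun v => (v \in S :\ v0) && p v)); last first.
    by move=> v; rewrite in_setD1 andbC andbA.
  by apply: ler_sum => v /andP[/setD1P[_ vS] pv]; exact: fg.
have KM0 : 0 <= 1 + K * M by rewrite addr_ge0 ?mulr_ge0.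
have empty (p : pred I) : (forall v, ~~ ((v \in S) && p v)) ->
    \sum_(v in S | p v) f v <= 1 + K * M.
  by move=> np; rewrite big_pred0 // => v; apply/negbTE.
rewrite (bigID (fun v => D v <= len v)) /= mulr_natl mulr2n lerD //.
  case: (pickP (fun v => (v \in S) && (D v <= len v))) => [i0 pi0|none]; last first.
    by apply: empty => v; rewrite none.
  case: (@arg_minP _ _ _ i0 (fun v => (v \in S) && (D v <= len v)) len pi0).
  move=> v0 /andP[v0S Dv0] v0min.
  (* Here [kappa v0 <= 2 * len v0], so [d v0 v <= D v + 2 * len v0]. If [d v0 v] exceeds
     [4 * len v0], then [2 * len v0 < D v] and [d v0 v <= 2 * D v]. *)
  apply: (part _ v0) => // v vS Dv.
  have lev : len v0 <= len v by apply: v0min; rewrite vS.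
  have := dk _ _ v0S vS; have := kD _ v0S; have l0 := len0 v0.
  have [le4 _ _|lt4 h1 h2] := lerP (d v0 v) (4 * len v0).
    by apply: le_trans (near _ _ v0S vS lev le4).
  by apply: far => //; lra.
case: (pickP (fun v => (v \in S) && ~~ (D v <= len v))) => [i0 pi0|none]; last first.
  by apply: empty => v; rewrite none.
case: (@arg_minP _ _ _ i0 (fun v => (v \in S) && ~~ (D v <= len v)) kappa pi0).
move=> v0 /andP[v0S Dv0] v0min.
(* Now [kappa v0 <= kappa v <= D v + len v < 2 * D v], hence [d v0 v <= 3 * D v]: this is the source
   of the [3]. *)
apply: (part _ v0) => // v vS Dv.
have : kappa v0 <= kappa v by apply: v0min; rewrite vS.
have := dk _ _ v0S vS; have := kD _ vS; have l0 := len0 v.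
by move: Dv; rewrite -ltNge => *; apply: far => //; lra.
Qed.

(** Both quotients have the form [min(1, p / x)]: the uncapped ratio grows by at most [K] on passing
    from the right to the left, and the cap [1] is at most [K]. *)
Lemma le_capped_ratio (R : realType) (p p' x x' K : R) : 0 < p -> p <= p' ->
    0 <= x -> 1 <= K -> x' <= K * x ->
  p / Num.max p x <= K * (p' / Num.max p' x').
Proof.
move=> p0 pp' x0 K1 xx'.
have p'0 : 0 < p' by exact: lt_le_trans pp'.
have K0 : 0 <= K by lra.
rewrite mulrA ler_pdivrMr ?lt_max ?p0 // mulrAC ler_pdivlMr ?lt_max ?p'0 //.
rewrite -[K * p' * _]mulrA.
have m1 : p <= Num.max p x by rewrite le_max lexx.
have m2 : x <= Num.max p x by rewrite le_max lexx orbT.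
set y := Num.max p x in m1 m2 *.
have h : p * p' <= K * (p' * y).
  rewrite mulrC -[leLHS]mul1r ler_pM // ?ler_pM2l //.
  by rewrite mulr_ge0 // ltW.
rewrite /Num.max; case: ifP => _ //.
apply: (@le_trans _ _ (p' * (K * x))).
  apply: (@le_trans _ _ (p * (K * x))); first by rewrite ler_pM2l.
  by rewrite ler_wpM2r ?mulr_ge0.
by rewrite mulrCA ler_wpM2l // ler_pM2l.
Qed.

Section LongerLinks.
Variables (R : realType) (alpha beta noise : R) (m : link_model).
Variables (X : metricType R) (I : finType) (L : I -> link X) (P : I -> R).

Local Notation len v := (link_length (L v)).
Local Notation dist w v := (link_dist m (L w) (L v)).
Local Notation gap := (margin alpha beta noise L P).
Local Notation aff := (affectance alpha beta noise m L P).

Hypothesis alpha0 : 0 < alpha.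
Hypothesis beta1 : 1 <= beta.
Hypothesis noise0 : 0 <= noise.
Hypothesis len_gt0 : forall v, 0 < len v.
Hypothesis P_gt0 : forall v, 0 < P v.
Hypothesis margin_ge0 : forall v, 0 <= gap v.

Lemma le_affectance (w v w' v' : I) (K : R) : 1 <= K -> P w <= P w' ->
    gap v' * dist w' v' `^ alpha <= K * (gap v * dist w v `^ alpha) ->
  aff w v <= K * aff w' v'.
Proof.
by move=> K1 Pw le_d; apply: le_capped_ratio; rewrite ?mulr_ge0 ?powR_ge0.
Qed.

Lemma affectance_ge (w v : I) (K : R) : 1 <= K ->
    gap v * dist w v `^ alpha <= K * P w -> 1 <= K * aff w v.
Proof.
move=> K1 le_d; rewrite /affectance mulrA ler_pdivlMr ?lt_max ?P_gt0 // mul1r.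
by rewrite ge_max le_d andbT ler_peMl // ltW.
Qed.

Lemma powR_le (x y : R) : 0 <= x -> x <= y -> x `^ alpha <= y `^ alpha.
Proof.
move=> x0 xy; apply: ge0_ler_powR; rewrite ?nnegrE ?(ltW alpha0) //.
exact: le_trans xy.
Qed.

Lemma powR_scale (K x y : R) : 0 <= K -> 0 <= x -> 0 <= y -> x <= K * y ->
  x `^ alpha <= K `^ alpha * y `^ alpha.
Proof. by move=> K0 x0 y0 xy; rewrite -powRM // powR_le. Qed.

Hypothesis Pmono : length_monotone (fun v => len v) P.
Hypothesis Psub : sub_linear alpha (fun v => len v) P.

(** Up to [beta] and [noise] the margin is [P v / len v ^ alpha], so this is sub-linearity. *)
Lemma margin_anti (u v : I) : len u <= len v -> gap v <= gap u.
Proof.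
move=> uv; rewrite /margin lerD2r !(mulrC beta) !invfM !mulrA.
by rewrite ler_pM2r ?invr_gt0 ?(lt_le_trans ltr01) //; exact: Psub.
Qed.

Let K4 : 1 <= (4 : R) `^ alpha.
Proof. by have := @powR_le 1 4; rewrite powR1; apply; lra. Qed.

(** The effect of [v] on [u] is compared with its effect on the reference link [v0], which is longer
    than [u] and hence tolerates no more. If [v] is within [4 * len v0] of [v0], then [P v0 <= P v]
    makes its affectance on [v0] at least [4 ^ - alpha]. *)
Lemma affectance_from_longer (S : {set I}) (u : I) (M : R) : 0 <= M ->
    (forall v, v \in S -> \sum_(w in S :\ v) aff w v <= M) ->
    (forall v, v \in S -> len u <= len v) ->
  \sum_(v in S) aff v u <= 2 * (1 + 4 `^ alpha * M).
Proof.
move=> M0 inM longer; have [k [k1 k2]] := into_detour m (L u).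
have d0 w v : 0 <= dist w v by exact: dist_ge0.
apply: (sum_comparison (g := fun v0 v => aff v v0) (d := fun v0 v => dist v v0)
  (len := fun v => len v) (D := fun v => dist v u) (kappa := fun v => k (L v))) => //.
- by move=> v; exact: affectance_le1.
- by move=> v0 v; exact: affectance_ge0.
- move=> v0 v v0S vS D0 dD; apply: le_affectance => //.
  rewrite mulrCA ler_pM ?powR_ge0 ?margin_anti ?longer //.
  by apply: powR_scale => //; lra.
- move=> v0 v v0S vS lev d4; apply: affectance_ge => //.
  apply: (@le_trans _ _ (gap v0 * (4 `^ alpha * len v0 `^ alpha))).
    by rewrite ler_wpM2l //; apply: powR_scale => //; rewrite ltW.
  rewrite mulrCA ler_wpM2l ?powR_ge0 //.
  by apply: le_trans (Pmono lev); exact: margin_lenX.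
- by move=> v vS; apply: k1; exact: longer.
Qed.

(** The two power conditions swap roles: [P u <= P v0] lets [v0] replace [u] as the source, and the
    decreasing margin handles the near case. Feasibility bounds incoming affectances only, so the
    outgoing bound [M] is assumed here and obtained later by averaging. *)
Lemma affectance_to_longer (S : {set I}) (u : I) (M : R) : 0 <= M ->
    (forall w, w \in S -> \sum_(v in S :\ w) aff w v <= M) ->
    (forall v, v \in S -> len u <= len v) ->
  \sum_(v in S) aff u v <= 2 * (1 + 4 `^ alpha * M).
Proof.
move=> M0 outM longer; have [k [k1 k2]] := out_detour m (L u).
have d0 w v : 0 <= dist w v by exact: dist_ge0.
apply: (sum_comparison (g := fun v0 v => aff v0 v) (d := fun v0 v => dist v0 v)
  (len := fun v => len v) (D := fun v => dist u v) (kappa := fun v => k (L v))) => //.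
- by move=> v; exact: affectance_le1.
- by move=> v0 v; exact: affectance_ge0.
- move=> v0 v v0S vS D0 dD; apply: le_affectance => //;
    first by apply: Pmono; exact: longer.
  rewrite mulrCA ler_wpM2l //.
  by apply: powR_scale => //; lra.
- move=> v0 v v0S vS lev d4; apply: affectance_ge => //.
  apply: (@le_trans _ _ (gap v * (4 `^ alpha * len v0 `^ alpha))).
    by rewrite ler_wpM2l //; apply: powR_scale => //; rewrite ltW.
  rewrite mulrCA ler_wpM2l ?powR_ge0 //.
  apply: le_trans (_ : gap v0 * len v0 `^ alpha <= _); last exact: margin_lenX.
  by rewrite ler_wpM2r ?powR_ge0 ?margin_anti.
- by move=> v vS; apply: k1; exact: longer.
Qed.

End LongerLinks.

(** * Dual links *)

Section DualLinks.
Variables (R : realType) (alpha beta noise : R).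
Variables (X : metricType R) (I : finType) (L : I -> link X) (P : I -> R).

Local Notation len v := (link_length (L v)).
Local Notation gap := (margin alpha beta noise L P).
Local Notation aff m := (affectance alpha beta noise m L P).
Local Notation dual_aff m :=
  (affectance alpha beta noise m (fun v => dual_link (L v)) P).

Lemma dual_length (l : link X) : link_length (dual_link l) = link_length l.
Proof. by rewrite /link_length metric_sym. Qed.

Lemma dual_margin (v : I) :
  margin alpha beta noise (fun v => dual_link (L v)) P v = gap v.
Proof. by rewrite /margin dual_length. Qed.

Hypothesis alpha0 : 0 < alpha.
Hypothesis beta1 : 1 <= beta.
Hypothesis noise0 : 0 <= noise.
Hypothesis len_gt0 : forall v, 0 < len v.
Hypothesis P_gt0 : forall v, 0 < P v.
Hypothesis margin_ge0 : forall v, 0 <= gap v.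

(** The two premises are what [succeeds_received] yields for two links of one feasible set. *)
Definition dual_tame (m : link_model) : Prop := forall w v,
  P w <= gap v * link_dist m (L w) (L v) `^ alpha ->
  P v <= gap w * link_dist m (L v) (L w) `^ alpha ->
  dual_aff m w v <= 3 `^ alpha * aff m w v.

Let K3 : 1 <= (3 : R) `^ alpha.
Proof. by have := powR_le alpha0 (@ler01 R) (ler_nat R 1 3); rewrite powR1. Qed.

(** Reversing both links preserves the bi-directional distance, so the two affectances coincide. *)
Lemma bidirectional_tame : dual_tame Bidirectional.
Proof.
move=> w v _ _; rewrite {1}/affectance dual_margin bidirectional_dual.
by rewrite ler_peMl // affectance_ge0.
Qed.

(** Let [x] and [y] be the primal and dual distances, so [x <= z + 2 * y]. If [z < y], then
    [x <= 3 * y] and the ratios compare. Otherwise [x <= 3 * z], the primal affectance is at least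
    [3 ^ - alpha], and the dual one is at most [1]. *)
Lemma unidirectional_dual_le (w v : I) (z : R) : 0 <= z ->
    mdist (L w).1 (L v).2 <= z + 2 * mdist (L v).1 (L w).2 ->
    gap v * z `^ alpha <= P w ->
  dual_aff Unidirectional w v <= 3 `^ alpha * aff Unidirectional w v.
Proof.
move=> z0; rewrite /affectance dual_margin /= (metric_sym (L w).2).
set x := mdist _ _; set y := mdist _ _ => le_x gz.
have [yz|zy] := lerP y z; last first.
  apply: le_capped_ratio; rewrite ?mulr_ge0 ?powR_ge0 // mulrCA ler_wpM2l //.
  by apply: powR_scale; rewrite ?mdist_ge0 //; lra.
apply: (@le_trans _ _ 1).
  by rewrite ler_pdivrMr ?lt_max ?P_gt0 // mul1r le_max lexx.
rewrite -[P w / Num.max _ _]/(aff Unidirectional w v).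
apply: affectance_ge => //=.
apply: (@le_trans _ _ (gap v * (3 `^ alpha * z `^ alpha))).
  rewrite ler_wpM2l //; apply: powR_scale; rewrite ?mdist_ge0 //.
  by rewrite -/x; lra.
by rewrite mulrCA ler_wpM2l ?powR_ge0.
Qed.

Lemma le_of_powR (x y : R) : 0 <= y -> x `^ alpha <= y `^ alpha -> x <= y.
Proof.
move=> y0 xy; rewrite leNgt; apply/negP => yx; move: xy.
apply/negP; rewrite -ltNge; apply: gt0_ltr_powR; rewrite ?nnegrE //.
by rewrite (le_trans y0) // ltW.
Qed.

Lemma unidirectional_detour (w v : I) :
  mdist (L w).1 (L v).2 <= len w + mdist (L v).1 (L w).2 + len v.
Proof.
apply: le_trans (metric_triangle _ (L v).1 _) _; rewrite lerD2r.
by rewrite (metric_sym (L v).1); exact: metric_triangle.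
Qed.

Lemma uniform_tame : uniform_power (fun v => len v) P -> dual_tame Unidirectional.
Proof.
move=> unif w v _; rewrite (unif v w) /= => Pv.
have g0 : 0 < gap w.
  rewrite lt_def margin_ge0 andbT; apply: contraTneq Pv => ->.
  by rewrite mul0r -ltNge.
apply: (@unidirectional_dual_le _ _ (len v)); first exact: ltW.
  apply: le_trans (unidirectional_detour w v) _.
  (* Equal powers make [gap w * len w ^ alpha] at most the power of [v], which by tolerance is at
     most [gap w] times the distance to the power [alpha]. *)
  suff : len w <= mdist (L v).1 (L w).2 by lra.
  apply: le_of_powR; rewrite ?mdist_ge0 // -(ler_pM2l g0).
  by apply: le_trans Pv; exact: margin_lenX.
by rewrite (unif w v); exact: margin_lenX.
Qed.

Lemma linear_tame : linear_power alpha (fun v => len v) P ->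
  dual_tame Unidirectional.
Proof.
move=> [c lin] w v _ /= Pv.
(* Under linear power all margins agree, so [v] takes the place that [w] has in the uniform case:
   [len v] is bounded by the distance, and [z] is [len w]. *)
have gE u : gap u = c / beta - noise.
  by rewrite /margin lin invfM mulrACA divff ?mulr1 // gt_eqF ?lenX_gt0.
have gwv : gap w = gap v by rewrite !gE.
have g0 : 0 < gap w.
  rewrite lt_def margin_ge0 andbT; apply: contraTneq Pv => ->.
  by rewrite mul0r -ltNge.
apply: (@unidirectional_dual_le _ _ (len w)); first exact: ltW.
  apply: le_trans (unidirectional_detour w v) _.
  suff : len v <= mdist (L v).1 (L w).2 by lra.
  apply: le_of_powR; rewrite ?mdist_ge0 // -(ler_pM2l g0).
  by apply: le_trans Pv; rewrite gwv; exact: margin_lenX.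
by rewrite -gwv; exact: margin_lenX.
Qed.

Lemma uniform_monotone_sub_linear :
  uniform_power (fun v => len v) P -> monotone_sub_linear alpha (fun v => len v) P.
Proof.
move=> unif; split=> v w wv; first by rewrite (unif w v).
rewrite (unif v w) ler_pM2l // lef_pV2 ?posrE ?lenX_gt0 //.
by apply: powR_le => //; exact: ltW.
Qed.

Lemma linear_monotone_sub_linear :
  linear_power alpha (fun v => len v) P -> monotone_sub_linear alpha (fun v => len v) P.
Proof.
move=> [c lin]; split=> v w wv; rewrite !lin.
  have c0 : 0 < c by rewrite -(pmulr_lgt0 _ (lenX_gt0 alpha len_gt0 v)) -lin.
  by rewrite ler_pM2l //; apply: powR_le => //; exact: ltW.
by rewrite !mulfK // gt_eqF ?lenX_gt0.
Qed.

End DualLinks.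

(** * Averaging over the classes of a schedule *)

(** Incoming sums at most [1] give total weight at most [#|S|] inside the classes, so at least half
    of the links have outgoing weight at most [2]. Every pair is then charged to its shorter link,
    at cost [C] for each of the [#|Q|] classes. *)
Lemma light_subset (R : realType) (I K : finType) (Q : {set K}) (col : I -> K)
    (a b : I -> I -> R) (len : I -> R) (C : R) (S : {set I}) :
    (forall w v, 0 <= a w v) -> (forall w v, 0 <= b w v) ->
    (forall v, col v \in Q) -> 0 <= C ->
    (forall v, \sum_(w | (w != v) && (col w == col v)) a w v <= 1) ->
    (forall u k, \sum_(w | (col w == k) && (len u <= len w)) b w u <= C) ->
    (forall u k (S' : {set I}), (forall v, v \in S' -> col v = k) ->
       (forall w, w \in S' -> \sum_(v in S' :\ w) a w v <= 2) ->
       (forall v, v \in S' -> len u <= len v) -> \sum_(v in S') b u v <= C) ->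
  exists S' : {set I}, [/\ S' \subset S, (#|S| <= 2 * #|S'|)%N &
    \sum_(v in S') \sum_(w in S :\ v) b w v <= 2 * C * #|Q|%:R * #|S|%:R].
Proof.
move=> a0 b0 colQ C0 in1 bin bout.
pose out w := \sum_(v in S | (v != w) && (col v == col w)) a w v.
exists [set w in S | out w <= 2].
set S' := [set w in S | _].
have sub : S' \subset S by apply/subsetP => w; rewrite inE => /andP[].
split=> //.
- have out_le : \sum_(w in S) out w <= #|S|%:R.
    rewrite /out (exchange_big_dep (mem S)) //=; last by move=> w v _ /andP[].
    rewrite -sumr_const; apply: ler_sum => v vS; apply: le_trans (in1 v).
    rewrite [leRHS](bigID (mem S)) /= -[leLHS]addr0 lerD //; last by rewrite sumr_ge0.
    rewrite le_eqVlt; apply/orP; left; apply/eqP; apply: eq_bigl => w.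
    by rewrite vS /= eq_sym [col v == _]eq_sym andbC.
  have : 2 * #|S :\: S'|%:R <= \sum_(w in S) out w.
    rewrite (bigID (mem S')) /= mulr_natl -sumr_const -sumrMnl -[leLHS]add0r lerD //.
      by rewrite sumr_ge0 // => w _; rewrite sumr_ge0.
    rewrite [leLHS](eq_bigl (fun w => (w \in S) && (w \notin S'))); last first.
      by move=> w; rewrite in_setD andbC.
    apply: ler_sum => w /andP[wS]; rewrite inE wS /= -ltNge => /ltW.
    by [].
  move=> /le_trans /(_ out_le); rewrite -natrM ler_nat.
  rewrite -(cardsID S' S) (setIidPr sub) mulSn mul1n => le_out.
  by rewrite !mulSn !mul0n !addn0 leq_add2l -(leq_add2r #|S :\: S'|).
have classes (p : pred I) (f : I -> R) :
    (forall k, \sum_(w | p w && (col w == k)) f w <= C) ->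
    \sum_(w | p w) f w <= C * #|Q|%:R.
  move=> fC; rewrite (partition_big col (mem Q)) //=.
  apply: (@le_trans _ _ (\sum_(k in Q) C)); first by apply: ler_sum => k _.
  by rewrite sumr_const mulr_natr.
have longer : \sum_(v in S') \sum_(w | len v <= len w) b w v
    <= C * #|Q|%:R * #|S|%:R.
  apply: (@le_trans _ _ (\sum_(v in S') C * #|Q|%:R)).
    apply: ler_sum => v _; apply: classes => k.
    by under eq_bigl do rewrite andbC; exact: bin.
  rewrite sumr_const -[leLHS]mulr_natr ler_wpM2l ?mulr_ge0 ?ler0n //.
  by rewrite ler_nat subset_leq_card.
(* After exchanging the sums the shorter link [w] is fixed and [v] runs over longer light links;
   [bout] applies since a subset of light links inherits the outgoing bound [2]. *)
have shorter : \sum_(v in S') \sum_(w in S | len w <= len v) b w v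
    <= C * #|Q|%:R * #|S|%:R.
  rewrite (exchange_big_dep (mem S)) /=; last by move=> v w _ /andP[].
  apply: (@le_trans _ _ (\sum_(v in S) C * #|Q|%:R)); last first.
    by rewrite sumr_const -[leLHS]mulr_natr.
  apply: ler_sum => w wS; apply: classes => k.
  pose S'' := [set v in S' | (len w <= len v) && (col v == k)].
  rewrite (eq_bigl (mem S'')); last first.
    by move=> v; rewrite !inE wS /= -!andbA.
  apply: (bout _ k).
  - by move=> v; rewrite inE => /and3P[_ _ /eqP].
  - move=> v; rewrite inE => /and3P[vS' _ /eqP vk].
    move: vS'; rewrite inE => /andP[vS]; apply: le_trans.
    rewrite /out [leRHS](bigID (mem S'')) /= -[leLHS]addr0 lerD //; last by rewrite sumr_ge0.
    rewrite le_eqVlt; apply/orP; left; apply/eqP; apply: eq_bigl => x.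
    rewrite !inE vk; case: (x \in S) => //=; case: (x != v) => //=.
    by case: (col x == k); rewrite ?andbF ?andbT.
  - by move=> v; rewrite inE => /and3P[].
(* Pairs of equal length may be counted in both sums, which is harmless as [b] is nonnegative. *)
have -> : 2 * C * #|Q|%:R * #|S|%:R =
  C * #|Q|%:R * #|S|%:R + C * #|Q|%:R * #|S|%:R by ring.
apply: le_trans (lerD longer shorter); rewrite -big_split /=.
apply: ler_sum => v vS'.
rewrite [leLHS](bigID (fun w => len v <= len w)) /= lerD //.
  rewrite [leRHS](bigID (mem (S :\ v))) /= -[leLHS]addr0 lerD //; last by rewrite sumr_ge0.
  by rewrite le_eqVlt; apply/orP; left; apply/eqP; apply: eq_bigl => w; rewrite andbC.
rewrite [leRHS](bigID (fun w => (w \in S :\ v) && ~~ (len v <= len w))) /=.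
rewrite -[leLHS]addr0 lerD //; last by rewrite sumr_ge0.
rewrite le_eqVlt; apply/orP; left; apply/eqP; apply: eq_bigl => w.
rewrite -ltNge in_setD1; case: ltP => [/ltW ->|]; rewrite ?andbF ?andbT //.
by case: (w \in S); rewrite ?andbF.
Qed.

(** * Affectance in scheduled sets *)

Section Schedule.
Variables (R : realType) (alpha beta noise : R) (m : link_model).
Variables (X : metricType R) (I : finType) (L : I -> link X) (P : I -> R).

Local Notation len v := (link_length (L v)).
Local Notation gap := (margin alpha beta noise L P).
Local Notation aff := (affectance alpha beta noise m L P).
Local Notation dual_aff :=
  (affectance alpha beta noise m (fun v => dual_link (L v)) P).

(** With realized acknowledgements a sum of loads below [1] covers both the message and its
    acknowledgement. *)
Definition load (a : ack_model) (w v : I) : R :=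
  match a with
  | RealizedAcks => aff w v + dual_aff w v
  | CheapAcks _ => aff w v
  end.

(** The two inner terms are the comparison bound with [M = 2] for primal links and
    [M = 3 ^ alpha * 2] for dual ones. The outer [2] counts longer and shorter partners. *)
Definition load_const : R :=
  2 * (2 * (1 + 4 `^ alpha * 2) + 2 * (1 + 4 `^ alpha * (3 `^ alpha * 2))).

Hypothesis alpha0 : 0 < alpha.
Hypothesis beta1 : 1 <= beta.
Hypothesis noise0 : 0 <= noise.
Hypothesis len_gt0 : forall v, 0 < len v.
Hypothesis P_gt0 : forall v, 0 < P v.
Hypothesis Pms : monotone_sub_linear alpha (fun v => len v) P.

Variable Q : {set {set I}}.
Hypothesis schedQ : is_schedule alpha beta noise m L P Q.

Let col := pblock Q.

Lemma dual_length_gt0 (v : I) : 0 < link_length (dual_link (L v)).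
Proof. by rewrite dual_length. Qed.

Lemma schedule_cover (v : I) : v \in cover Q.
Proof. by have [/and3P[/eqP-> _ _] _] := schedQ; rewrite inE. Qed.

Lemma schedule_succeeds (v : I) : succeeds alpha beta noise m L P (pblock Q v) v.
Proof.
have [_ feasQ] := schedQ.
have := feasQ _ (pblock_mem (schedule_cover v)).
by move=> /forallP/(_ v)/implyP; apply; rewrite mem_pblock schedule_cover.
Qed.

Lemma schedule_class (w v : I) : (col w == col v) = (w \in pblock Q v).
Proof.
have [/and3P[_ tI _] _] := schedQ.
by rewrite eq_sym eq_pblock // schedule_cover.
Qed.

Lemma schedule_margin (v : I) : 0 <= gap v.
Proof. by apply: succeeds_margin (schedule_succeeds v). Qed.

Lemma aff_ge0 w v : 0 <= aff w v. Proof. exact: affectance_ge0. Qed.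

Lemma dual_aff_ge0 w v : 0 <= dual_aff w v. Proof. exact: affectance_ge0. Qed.

Lemma load_ge0 a w v : 0 <= load a w v.
Proof.
case: a => [|k]; last exact: aff_ge0.
by apply: addr_ge0; [exact: aff_ge0|exact: dual_aff_ge0].
Qed.

Lemma schedule_affectance (v : I) :
  \sum_(w | (w != v) && (col w == col v)) aff w v <= 1.
Proof.
rewrite (eq_bigl (mem (pblock Q v :\ v))); last first.
  by move=> w; rewrite /= schedule_class in_setD1.
exact: succeeds_affectance (schedule_succeeds v).
Qed.

Section OneClass.
Variables (S : {set I}) (k : {set I}).
Hypothesis colS : forall v, v \in S -> col v = k.

(** The bound [1] is relaxed to [2] to share [load_const] with the outgoing case. *)
Lemma class_affectance (v : I) : v \in S -> \sum_(w in S :\ v) aff w v <= 2.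
Proof.
move=> vS; apply: le_trans (le_trans (schedule_affectance v) _); last by lra.
rewrite [leRHS](bigID (mem S)) /= -[leLHS]addr0 lerD //; last first.
  by rewrite sumr_ge0 // => *; exact: aff_ge0.
rewrite le_eqVlt; apply/orP; left; apply/eqP; apply: eq_bigl => w.
by rewrite in_setD1; case wS: (w \in S); rewrite ?andbF // !colS // eqxx !andbT.
Qed.

Hypothesis tame : dual_tame alpha beta noise L P m.

Lemma class_dual_le (w v : I) : w \in S -> v \in S -> w != v ->
  dual_aff w v <= 3 `^ alpha * aff w v.
Proof.
move=> wS vS wv.
apply: tame.
  apply: succeeds_received (schedule_succeeds v) _ wv => //.
  by rewrite -schedule_class !colS.
rewrite eq_sym in wv; apply: succeeds_received (schedule_succeeds w) _ wv => //.
by rewrite -schedule_class !colS.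
Qed.

End OneClass.

Lemma class_in a u k : (a = RealizedAcks -> dual_tame alpha beta noise L P m) ->
  \sum_(w | (col w == k) && (len u <= len w)) load a w u <= load_const / 2.
Proof.
move=> tame; pose S := [set w | (col w == k) && (len u <= len w)].
rewrite (eq_bigl (mem S)); last by move=> w; rewrite /= inE.
have colS v : v \in S -> col v = k by rewrite inE => /andP[/eqP].
have lenS v : v \in S -> len u <= len v by rewrite inE => /andP[].
have prim : \sum_(v in S) aff v u <= 2 * (1 + 4 `^ alpha * 2).
  apply: affectance_from_longer => //; try exact: schedule_margin; try by case: Pms.
  by move=> v vS; exact: class_affectance colS _ vS.
rewrite /load_const [2 * _]mulrC mulfK // /load.
case: a tame => [/(_ erefl) tame|? _]; last first.
  apply: le_trans prim _.
  by rewrite lerDl mulr_ge0 // addr_ge0 // !mulr_ge0 // powR_ge0.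
rewrite big_split /= lerD //.
apply: affectance_from_longer => //.
- exact: dual_length_gt0.
- by move=> v; rewrite dual_margin schedule_margin.
- by have [Pm _] := Pms; move=> v w; rewrite !dual_length; exact: Pm.
- by have [_ Ps] := Pms; move=> v w; rewrite !dual_length; exact: Ps.
- move=> v vS; apply: le_trans (ler_wpM2l (powR_ge0 _ _) (class_affectance colS vS)).
  rewrite mulr_sumr; apply: ler_sum => w; rewrite in_setD1 => /andP[wv wS].
  exact: class_dual_le colS tame _ _ _ _ _.
- by move=> v vS; rewrite !dual_length lenS.
Qed.

Lemma class_out a u k (S : {set I}) :
    (a = RealizedAcks -> dual_tame alpha beta noise L P m) ->
    (forall v, v \in S -> col v = k) ->
    (forall w, w \in S -> \sum_(v in S :\ w) aff w v <= 2) ->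
    (forall v, v \in S -> len u <= len v) ->
  \sum_(v in S) load a u v <= load_const / 2.
Proof.
move=> tame colS outS lenS.
have prim : \sum_(v in S) aff u v <= 2 * (1 + 4 `^ alpha * 2).
  by apply: affectance_to_longer => //; try exact: schedule_margin; case: Pms.
rewrite /load_const [2 * _]mulrC mulfK // /load.
case: a tame => [/(_ erefl) tame|? _]; last first.
  apply: le_trans prim _.
  by rewrite lerDl mulr_ge0 // addr_ge0 // !mulr_ge0 // powR_ge0.
rewrite big_split /= lerD //.
apply: affectance_to_longer => //.
- exact: dual_length_gt0.
- by move=> v; rewrite dual_margin schedule_margin.
- by have [Pm _] := Pms; move=> v w; rewrite !dual_length; exact: Pm.
- by have [_ Ps] := Pms; move=> v w; rewrite !dual_length; exact: Ps.
- move=> w wS; apply: le_trans (ler_wpM2l (powR_ge0 _ _) (outS _ wS)).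
  rewrite mulr_sumr; apply: ler_sum => v; rewrite in_setD1 eq_sym => /andP[wv vS].
  exact: class_dual_le colS tame _ _ _ _ _.
- by move=> v vS; rewrite !dual_length lenS.
Qed.

Lemma load_const_ge0 : 0 <= load_const.
Proof. by rewrite /load_const !(mulr_ge0, addr_ge0, powR_ge0). Qed.

Lemma schedule_light_subset a (S : {set I}) :
    (a = RealizedAcks -> dual_tame alpha beta noise L P m) ->
  exists S' : {set I}, [/\ S' \subset S, (#|S| <= 2 * #|S'|)%N &
    \sum_(v in S') \sum_(w in S :\ v) load a w v
      <= load_const * #|Q|%:R * #|S|%:R].
Proof.
move=> tame.
have [] := @light_subset R I _ Q col aff (load a) (fun v => len v)
  (load_const / 2) S aff_ge0 (load_ge0 a) _ _ schedule_affectance.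
- by move=> v; rewrite pblock_mem ?schedule_cover.
- by rewrite divr_ge0 ?load_const_ge0.
- by move=> u k; exact: class_in.
- by move=> u k S' colS' outS' lenS'; exact: class_out colS' outS' lenS'.
move=> S' [sub card le]; exists S'; split=> //.
by move: le; rewrite [2 * (_ / 2)]mulrC divfK.
Qed.

End Schedule.

(** * Executions *)

(** The probability that a random set with independent members contains [A], obtained by expanding a
    product of sums. Empty, singleton and two-element [A] give the total mass and the first and
    second moments. *)
Lemma sum_prod_subset (R : comRingType) (E : finType) (p : E -> R) (A : {set E}) :
  \sum_(S : {set E}) (\prod_e (if e \in S then p e else 1 - p e))
    * (A \subset S)%:R = \prod_(e in A) p e.
Proof.
transitivity (\prod_e (p e + (if e \in A then 0 else 1 - p e))).
  rewrite bigA_distr; apply: eq_bigr => S _.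
  case: (boolP (A \subset S)) => [/subsetP AS|/subsetPn[e eA eS]].
    rewrite mulr1; apply: eq_bigr => e _; case: ifP => // /negbT eS.
    by case: ifP => // /AS eS'; rewrite eS' in eS.
  by rewrite mulr0 (bigD1 e) //= (negPf eS) eA mul0r.
rewrite [RHS]big_mkcond; apply: eq_bigr => e _.
by case: ifP => _; rewrite ?addr0 // addrC subrK.
Qed.

(** * The backoff algorithm *)

Section Backoff.
Variable R : realType.

(* The probability decreases like [4 log nhat / j], so that it stays within a
   factor [2] of the critical value for time [O(T log n)] whatever [T] is. *)
Definition backoff (nhat j : nat) : R :=
  (4 * up_log 2 nhat)%:R / (4 * up_log 2 nhat + j)%:R.

Lemma backoff01 nhat j : 0 <= backoff nhat j <= 1.
Proof.
rewrite /backoff; set l := (4 * _)%N; rewrite divr_ge0 ?ler0n //=.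
have [->|l0] := posnP l; first by rewrite mul0r ler01.
have lj : 0 < (l + j)%:R :> R by rewrite ltr0n addn_gt0 l0.
by rewrite ler_pdivrMr // mul1r ler_nat leq_addr.
Qed.

(** Odd slots are reserved for replies. Under cheap acknowledgements they stay silent, so one
    algorithm serves both models at the cost of a factor [2]. *)
Definition backoff_send (nhat : nat) (h : seq bool) : R :=
  if odd (size h) then 0 else backoff nhat (size h)./2.

Definition prompt_reply (nhat : nat) (h : seq (bool * bool)) : R :=
  (odd (size h) && (last (false, false) h).1)%:R.

Lemma backoff_send01 nhat h : 0 <= backoff_send nhat h <= 1.
Proof. by rewrite /backoff_send; case: ifP; rewrite ?lexx ?ler01 ?backoff01. Qed.

Lemma prompt_reply01 nhat h : 0 <= prompt_reply nhat h <= 1.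
Proof. by rewrite /prompt_reply ler0n lern1 leq_b1. Qed.

Definition backoff_algorithm := AckOnlyAlgorithm backoff_send01 prompt_reply01.

End Backoff.

(** * Expectations over executions *)

Section Runs.
Variables (R : realType) (alpha beta noise : R) (m : link_model).
Variables (a : ack_model) (A : ack_only_algorithm R) (nhat : nat).
Variables (X : metricType R) (I : finType) (L : I -> link X) (P : I -> R).

Local Notation slot := {set I * bool}.
Local Notation tprob := (transmit_prob alpha beta noise m a A nhat L P).
Local Notation sprob := (slot_prob alpha beta noise m a A nhat L P).
Local Notation eprob := (execution_prob alpha beta noise m a A nhat L P).
Local Notation acked := (acknowledged alpha beta noise m a L P).
Local Notation recvd := (received alpha beta noise m L P).

Definition expectation (t : nat) (f : seq slot -> R) : R :=
  \sum_(x : t.-tuple slot) eprob x * f x.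

Lemma transmit_prob01 h e : 0 <= tprob h e <= 1.
Proof.
case: e => v [] /=; last by case: ifP; rewrite ?lexx ?ler01 ?send_prob01.
case: a; last by rewrite lexx ler01.
by case: ifP; rewrite ?lexx ?ler01 ?reply_prob01.
Qed.

Lemma slot_prob_ge0 h S : 0 <= sprob h S.
Proof.
apply: prodr_ge0 => e _; have /andP[p0 p1] := transmit_prob01 h e.
by case: ifP => // _; rewrite subr_ge0.
Qed.

Lemma slot_prob_total h : \sum_S sprob h S = 1.
Proof.
have := sum_prod_subset (tprob h) set0; rewrite big_set0 => <-.
by apply: eq_bigr => S _; rewrite sub0set mulr1.
Qed.

Lemma slot_prob_in h S e : sprob h S != 0 -> e \in S -> tprob h e != 0.
Proof.
move=> p0 eS; apply: contraNneq p0 => t0.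
by rewrite /slot_prob (bigD1 e) //= eS t0 mul0r.
Qed.

Lemma slot_prob_notin h S e : sprob h S != 0 -> e \notin S -> tprob h e != 1.
Proof.
move=> p0 eS; apply: contraNneq p0 => t0.
by rewrite /slot_prob (bigD1 e) //= (negPf eS) t0 subrr mul0r.
Qed.

Lemma execution_prob_ge0 t (x : t.-tuple slot) : 0 <= eprob x.
Proof. by apply: prodr_ge0 => i _; exact: slot_prob_ge0. Qed.

Lemma execution_prob_rcons t (x : t.-tuple slot) S :
  eprob (rcons_tuple x S) = eprob x * sprob x S.
Proof.
rewrite /execution_prob big_ord_recr /=; congr (_ * _).
  apply: eq_bigr => i _; congr (sprob _ _).
    by rewrite -cats1 takel_cat // size_tuple ltnW.
  by rewrite !(tnth_nth set0) /= nth_rcons size_tuple ltn_ord.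
rewrite (tnth_nth set0) /= nth_rcons size_tuple ltnn eqxx; congr (sprob _ _).
by rewrite -cats1 take_size_cat // size_tuple.
Qed.

Lemma tuple_rcons t (x : t.+1.-tuple slot) :
  exists (y : t.-tuple slot) S, x = rcons_tuple y S.
Proof.
case/tupleP: x => S x; exists (belast_tuple S x), (last S x).
by apply: val_inj; rewrite /= lastI.
Qed.

Lemma sum_tuple_rcons t (f : t.+1.-tuple slot -> R) :
  \sum_x f x = \sum_(x : t.-tuple slot) \sum_S f (rcons_tuple x S).
Proof.
rewrite pair_bigA /= (reindex (fun p : t.-tuple slot * slot => rcons_tuple p.1 p.2)) //=.
apply: onW_bij; apply: inj_card_bij.
  move=> [x S] [y S'] /(congr1 val) /= /rcons_inj[xy ->].
  by congr (_, _); apply: val_inj.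
by rewrite card_prod !card_tuple expnSr.
Qed.

Lemma expectationS t f :
  expectation t.+1 f = expectation t (fun h => \sum_S sprob h S * f (rcons h S)).
Proof.
rewrite /expectation sum_tuple_rcons; apply: eq_bigr => x _.
rewrite mulr_sumr; apply: eq_bigr => S _.
by rewrite execution_prob_rcons mulrA.
Qed.

Lemma le_expectation t f g : (forall h, size h = t -> f h <= g h) ->
  expectation t f <= expectation t g.
Proof.
move=> fg; apply: ler_sum => x _; rewrite ler_wpM2l ?execution_prob_ge0 //.
by rewrite fg // size_tuple.
Qed.

Lemma expectationZ t c f : expectation t (fun h => c * f h) = c * expectation t f.
Proof. by rewrite /expectation mulr_sumr; apply: eq_bigr => x _; rewrite mulrCA. Qed.

Lemma execution_prob_total t : \sum_(x : t.-tuple slot) eprob x = 1.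
Proof.
elim: t => [|t IH].
  rewrite (big_pred1 [tuple]) => [|x]; last by apply/esym/eqP/val_inj; case: x => -[].
  by rewrite /execution_prob big_ord0.
rewrite sum_tuple_rcons -[RHS]IH; apply: eq_bigr => x _.
under eq_bigr do rewrite execution_prob_rcons.
by rewrite -mulr_sumr slot_prob_total mulr1.
Qed.

Definition unacked (h : seq slot) : {set I} := [set v | ~~ acked v h].

Lemma acknowledged_rcons v h S : acked v h -> acked v (rcons h S).
Proof.
rewrite /acknowledged /received; case: a => *; rewrite has_rcons; apply/orP; right=> //.
Qed.

Lemma card_unacked_rcons h S : (#|unacked (rcons h S)| <= #|unacked h|)%N.
Proof.
apply: subset_leq_card; apply/subsetP => v; rewrite !inE.
exact/contra/acknowledged_rcons.
Qed.

Lemma expectation_unackedS t :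
  expectation t.+1 (fun h => #|unacked h|%:R) <= expectation t (fun h => #|unacked h|%:R).
Proof.
rewrite expectationS; apply: le_expectation => h _.
apply: (@le_trans _ _ (\sum_S sprob h S * #|unacked h|%:R)).
  apply: ler_sum => S _; rewrite ler_wpM2l ?slot_prob_ge0 //.
  by rewrite ler_nat card_unacked_rcons.
by rewrite -mulr_suml slot_prob_total mul1r.
Qed.

Lemma received_rcons v h S :
  recvd v (rcons h S) = delivered alpha beta noise m L P (v, false) S || recvd v h.
Proof. exact: has_rcons. Qed.

(** A receiver that has not received its message acknowledges with probability [0]. So on executions
    of nonzero probability [completed] amounts to having no unacknowledged link. *)
Lemma acknowledged_received t (x : t.-tuple slot) v :
  eprob x != 0 -> acked v x -> recvd v x.
Proof.
rewrite /acknowledged; case aE: {2}a => [|//].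
have ack_in S : delivered alpha beta noise m L P (v, true) S -> (v, true) \in S.
  by case/andP.
move: (delivered _ _ _ _ _ _ (v, true)) ack_in => ack ack_in.
elim: t x => [|t IH] x px; first by rewrite tuple0.
have [y [S xE]] := tuple_rcons x; move: px.
rewrite xE execution_prob_rcons mulf_eq0 negb_or => /andP[py pS].
rewrite has_rcons received_rcons => /orP[/ack_in vS|/(IH y py) ->]; last first.
  by rewrite orbT.
have := slot_prob_in pS vS; rewrite /transmit_prob aE /=.
by case: (recvd v y); rewrite ?orbT ?eqxx.
Qed.

(** Markov's inequality: on failure the number of unacknowledged links is at least [1]. *)
Lemma completion_prob_ge t :
  1 - expectation t (fun h => #|unacked h|%:R) <=
  prob alpha beta noise m a A nhat L P t (completed alpha beta noise m a L P).
Proof.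
rewrite lerBlDr -[leLHS](execution_prob_total t).
rewrite (bigID (fun x : t.-tuple slot => completed alpha beta noise m a L P x)) /=.
rewrite /prob lerD2l /expectation.
rewrite [leRHS](bigID (fun x : t.-tuple slot => completed alpha beta noise m a L P x)) /=.
rewrite -[leLHS]add0r lerD //.
  by apply: sumr_ge0 => x _; rewrite mulr_ge0 ?execution_prob_ge0 ?ler0n.
apply: ler_sum => x /negP nc.
have [->|p0] := eqVneq (eprob x) 0; first by rewrite mul0r.
rewrite ler_peMr ?execution_prob_ge0 // (ler_nat _ 1) card_gt0.
apply/negP => /eqP U0; apply: nc; apply/forallP => v.
have av : acked v x.
  by apply: contraT => nv; have := in_set0 v; rewrite -U0 inE nv.
by rewrite av (acknowledged_received p0 av).
Qed.

End Runs.

Lemma sum_one_direction (R : realType) (I : finType) (T : {set I * bool})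
    (F : I * bool -> R) (c : bool) :
    (forall e, e \in T -> e.2 = c) ->
  \sum_(e in T) F e = \sum_(w | (w, c) \in T) F (w, c).
Proof.
move=> Tc; rewrite (reindex_onto (fun w => (w, c)) fst) /=.
  by apply: eq_bigl => w; rewrite eqxx andbT.
by case=> w b /Tc /= ->.
Qed.

(** * Drift over two consecutive slots *)

Section TwoSlots.
Variables (R : realType) (alpha beta noise : R) (m : link_model).
Variables (a : ack_model) (nhat : nat).
Variables (X : metricType R) (I : finType) (L : I -> link X) (P : I -> R).

Local Notation slot := {set I * bool}.
Local Notation A := (backoff_algorithm R).
Local Notation tprob := (transmit_prob alpha beta noise m a A nhat L P).
Local Notation sprob := (slot_prob alpha beta noise m a A nhat L P).
Local Notation acked := (acknowledged alpha beta noise m a L P).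
Local Notation recvd := (received alpha beta noise m L P).
Local Notation unacked := (unacked alpha beta noise m a L P).
Local Notation dlv := (delivered alpha beta noise m L P).
Local Notation gap := (margin alpha beta noise L P).
Local Notation aff := (affectance alpha beta noise m L P).
Local Notation dual_aff :=
  (affectance alpha beta noise m (fun v => dual_link (L v)) P).
Local Notation ld := (load alpha beta noise m L P a).

Hypothesis beta1 : 1 <= beta.
Hypothesis noise0 : 0 <= noise.
Hypothesis len_gt0 : forall v, 0 < link_length (L v).
Hypothesis P_gt0 : forall v, 0 < P v.
Hypothesis margin_ge0 : forall v, 0 <= gap v.

Lemma delivered_of_affectance (S : slot) (v : I) (b : bool) (F : I -> I -> R) :
    (v, b) \in S -> (forall e, e \in S -> e.2 = b) ->
    (forall w, affectance alpha beta noise m (node_link L) (node_power P) (w, b) (v, b)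
       <= F w v) ->
    \sum_(w | (w != v) && ((w, b) \in S)) F w v < 1 ->
  dlv (v, b) S.
Proof.
move=> vS Sb affF lt1; apply: succeeds_of_affectance => //.
- by case=> w []; rewrite /node_link //= dual_length.
- by move=> e; exact: P_gt0.
- by have := margin_ge0 v; rewrite /margin /node_link /node_power /=;
    case: (b); rewrite ?dual_length.
apply: le_lt_trans lt1; rewrite (@sum_one_direction _ _ _ _ b) => [|e]; last first.
  by rewrite in_setD1 => /andP[_]; exact: Sb.
rewrite (eq_bigl (fun w => (w != v) && ((w, b) \in S))); last first.
  by move=> w; rewrite in_setD1 xpair_eqE eqxx andbT.
by apply: ler_sum => w _; exact: affF.
Qed.

Section History.
Variables (h : seq slot).
Hypothesis even_h : ~~ odd (size h).

Let q := backoff R nhat (size h)./2.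

Lemma transmit_prob_unacked v : v \in unacked h -> tprob h (v, false) = q.
Proof.
by rewrite inE /= => /negPf->; rewrite /backoff_send size_map (negPf even_h).
Qed.

Lemma even_slot S e : sprob h S != 0 -> e \in S -> e.2 = false /\ e.1 \in unacked h.
Proof.
move=> pS eS; have := slot_prob_in pS eS; case: e eS => v [] vS /=; last first.
  by rewrite inE; case: ifP => // _; rewrite eqxx.
case: a; last by rewrite eqxx.
case: ifP; last by rewrite eqxx.
by rewrite /prompt_reply size_map (negPf even_h) eqxx.
Qed.

(** The links replying in [S2] are among those transmitting in [S1], so one bound on the load from
    [S1] makes both the message and the reply succeed. *)
Lemma two_slots_success S1 S2 v : sprob h S1 != 0 -> sprob (rcons h S1) S2 != 0 ->
    (v, false) \in S1 ->
    \sum_(w in unacked h :\ v) ld w v * ((w, false) \in S1)%:R < 1 ->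
  acked v (rcons (rcons h S1) S2).
Proof.
move=> p1 p2 vS1 lt1.
have loadE (p : pred I) : (forall w, p w -> (w, false) \in S1) ->
    \sum_(w | (w != v) && p w) ld w v < 1.
  move=> pS; apply: le_lt_trans lt1.
  rewrite [leLHS]big_mkcond [leRHS]big_mkcond; apply: ler_sum => w _.
  have l0 := load_ge0 alpha beta noise m L P_gt0 a w v.
  rewrite in_setD1; case: (w != v) => //=; case pw: (p w).
    have wS1 := pS _ pw; have [_ /= ->] := even_slot p1 wS1.
    by rewrite wS1 mulr1.
  by case: ifP => // _; rewrite mulr_ge0.
have dlv1 : dlv (v, false) S1.
  apply: (delivered_of_affectance (F := ld)) => //.
  - by move=> e /(even_slot p1)[].
  - move=> w; rewrite -[leLHS]/(aff w v) /load; case: (a) => [|k] //.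
    by rewrite lerDl; exact: dual_aff_ge0.
  - exact: loadE.
rewrite /acknowledged /received; case aE: a => [|k]; last by rewrite !has_rcons dlv1 orbT.
rewrite has_rcons; apply/orP; left.
have replyE w : reply_prob A nhat (receiver_view alpha beta noise m L P w (rcons h S1))
    = (dlv (w, false) S1)%:R.
  rewrite /= /prompt_reply /receiver_view map_rcons size_rcons size_map last_rcons.
  by rewrite /= even_h.
apply: (delivered_of_affectance (F := ld)).
(* After a delivery in [S1] the reply has probability exactly [1], so it cannot be missing from
   [S2]. *)
- apply: contraT => /(slot_prob_notin p2); rewrite /transmit_prob aE.
  by rewrite received_rcons dlv1 replyE dlv1 eqxx.
- case=> w [] // /(slot_prob_in p2); rewrite /= /backoff_send size_map size_rcons /= even_h.
  by rewrite if_same eqxx.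
- move=> w; rewrite aE -[leLHS]/(dual_aff w v) /= lerDr.
  exact: aff_ge0.
- apply: loadE => w /(slot_prob_in p2); rewrite /transmit_prob aE.
  case: ifP => _; last by rewrite eqxx.
  by rewrite replyE; case: (boolP (dlv _ _)) => [/andP[]|]; rewrite ?eqxx.
Qed.

(** The expected number of new acknowledgements is at least [q * #|S'| - q ^ 2 * D * #|U|], where
    [U] is the unacknowledged set; with [2 * #|S'| >= #|U|] and [q * D <= 1 / 4] this is at least
    [q * #|U| / 4]. *)
Lemma two_slots_drift (S' : {set I}) (D : R) :
    S' \subset unacked h -> (#|unacked h| <= 2 * #|S'|)%N ->
    \sum_(v in S') \sum_(w in unacked h :\ v) ld w v <= D * #|unacked h|%:R ->
    q * D <= 1 / 4 ->
  \sum_S1 sprob h S1 *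
    (\sum_S2 sprob (rcons h S1) S2 * #|unacked (rcons (rcons h S1) S2)|%:R)
  <= (1 - q / 4) * #|unacked h|%:R.
Proof.
move=> sub card_S' loadD qD.
have /andP[q0 q1] : 0 <= q <= 1 by exact: backoff01.
pose U := unacked h.
(* A lower bound for the indicator of success that is linear in the events of one or two links
   transmitting: it is at most [1], and at most [0] if [v] is silent or its load is at least [1]. *)
pose X1 (S : slot) (v : I) : R := ([set (v, false)] \subset S)%:R
  - \sum_(w in U :\ v) ld w v * ([set (v, false); (w, false)] \subset S)%:R.
have load0 := load_ge0 alpha beta noise m L P_gt0 a.
have pointwise S1 S2 : sprob h S1 != 0 -> sprob (rcons h S1) S2 != 0 ->
    #|unacked (rcons (rcons h S1) S2)|%:R <= #|U|%:R - \sum_(v in S') X1 S1 v.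
  move=> p1 p2; set V := unacked _.
  have VU : V \subset U.
    apply/subsetP => v; rewrite !inE; apply: contra => av.
    by do 2 apply: acknowledged_rcons.
  have -> : #|V|%:R = #|U|%:R - \sum_(v in U) (v \notin V)%:R :> R.
    rewrite -(cardsID V U) (setIidPr VU) natrD.
    suff -> : \sum_(v in U) (v \notin V)%:R = #|U :\: V|%:R :> R by lra.
    rewrite -sum1_card natr_sum big_mkcond [RHS]big_mkcond; apply: eq_bigr => v _.
    by rewrite in_setD; case: (v \in V); case: (v \in U).
  rewrite lerD2l lerN2 [leRHS](bigID (mem S')) /= -[leLHS]addr0 lerD ?sumr_ge0 //.
  rewrite [leRHS](eq_bigl (mem S')) => [|v]; last first.
    by rewrite andbC /=; case vS: (v \in S') => //=; exact: (subsetP sub).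
  apply: ler_sum => v vS'; rewrite /X1 sub1set.
  have le0 : 0 <= \sum_(w in U :\ v) ld w v * ([set (v, false); (w, false)] \subset S1)%:R.
    by apply: sumr_ge0 => w _; rewrite mulr_ge0.
  have [vS1|vS1] := boolP ((v, false) \in S1); last first.
    by apply: le_trans (_ : 0 <= _); [rewrite sub0r oppr_le0|rewrite ler0n].
  case: (boolP (v \in V)) => vV; last by rewrite lerBlDr lerDl.
  rewrite subr_le0 leNgt; apply/negP => lt1; move: vV; rewrite inE.
  apply/negP; rewrite negbK; apply: two_slots_success => //.
  apply: le_lt_trans lt1; apply: ler_sum => w _.
  by rewrite subUset !sub1set vS1.
apply: (@le_trans _ _ (\sum_S1 sprob h S1 * (#|U|%:R - \sum_(v in S') X1 S1 v))).
  apply: ler_sum => S1 _.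
  have [->|p1] := eqVneq (sprob h S1) 0; first by rewrite !mul0r.
  rewrite ler_wpM2l ?slot_prob_ge0 //.
  rewrite -[leRHS]mul1r.
  rewrite -[X in _ <= X * _](slot_prob_total alpha beta noise m a A nhat L P
    (rcons h S1)).
  rewrite mulr_suml; apply: ler_sum => S2 _.
  have [->|p2] := eqVneq (sprob (rcons h S1) S2) 0; first by rewrite !mul0r.
  by rewrite ler_wpM2l ?slot_prob_ge0 // pointwise.
(* Distinct unacknowledged links transmit independently, each with probability [q], so a pair has
   probability [q * q]. *)
have EX v : v \in S' -> \sum_S1 sprob h S1 * X1 S1 v
    = q - q * (q * \sum_(w in U :\ v) ld w v).
  move=> vS'; have vU := subsetP sub _ vS'.
  under eq_bigr do rewrite mulrBr mulr_sumr.
  rewrite big_split /= sum_prod_subset big_set1 transmit_prob_unacked //; congr (_ + _).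
  rewrite sumrN; congr (- _); rewrite exchange_big /= !mulr_sumr.
  apply: eq_bigr => w; rewrite in_setD1 => /andP[wv wU].
  under eq_bigr do rewrite mulrCA.
  rewrite -mulr_sumr sum_prod_subset big_setU1; last first.
    by rewrite inE xpair_eqE eq_sym (negPf wv).
  by rewrite big_set1 !transmit_prob_unacked //=; ring.
have -> : \sum_S1 sprob h S1 * (#|U|%:R - \sum_(v in S') X1 S1 v)
    = #|U|%:R - q * #|S'|%:R + q * (q * \sum_(v in S') \sum_(w in U :\ v) ld w v).
  under eq_bigr do rewrite mulrBr mulr_sumr.
  rewrite big_split /= -mulr_suml slot_prob_total mul1r sumrN exchange_big /=.
  rewrite (eq_bigr _ EX) big_split /= sumrN sumr_const -mulr_sumr -mulr_sumr.
  by rewrite opprD opprK addrA -[q *+ _]mulr_natr.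
have card_S'R : #|U|%:R <= 2 * #|S'|%:R :> R by rewrite -natrM ler_nat.
have U0 : 0 <= #|U|%:R :> R by [].
have h1 : q * \sum_(v in S') \sum_(w in U :\ v) ld w v <= 1 / 4 * #|U|%:R.
  apply: le_trans (ler_wpM2l q0 loadD) _.
  by rewrite mulrA ler_wpM2r.
have := ler_wpM2l q0 h1; have := ler_wpM2l q0 card_S'R; rewrite -/U.
move: (q * \sum_(_ in _) _) => z; nra.
Qed.

End History.

End TwoSlots.

(** * Decay of the number of unacknowledged links *)

Lemma bernoulli_le (R : realType) (x : R) (n : nat) : 0 <= x <= 1 ->
  1 - n%:R * x <= (1 - x) ^+ n.
Proof.
move=> /andP[x0 x1]; elim: n => [|n IH]; first by rewrite mul0r subr0 expr0.
rewrite exprS; apply: (@le_trans _ _ ((1 - x) * (1 - n%:R * x))).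
  rewrite -natr1; have : 0 <= n%:R * x * x by rewrite !mulr_ge0.
  nra.
by rewrite ler_wpM2l // subr_ge0.
Qed.

(** Bernoulli's inequality at [1 / (y + 1)], followed by [n / (y + 1) <= n / y]. It pays for the
    growth of the potential in one pair of slots. *)
Lemma backoff_step (R : realType) (y : R) (n : nat) : 0 < y ->
  (y + 1) ^+ n * (1 - n%:R / y) <= y ^+ n.
Proof.
move=> y0; have y10 : 0 < y + 1 by rewrite addr_gt0.
have -> : y ^+ n = (y + 1) ^+ n * (1 - (y + 1)^-1) ^+ n.
  by rewrite -exprMn mulrBr mulr1 divff ?gt_eqF // addrK.
rewrite ler_wpM2l ?exprn_ge0 ?(ltW y10) //.
apply: le_trans (bernoulli_le _ _); last first.
  by rewrite invr_ge0 ltW //= invf_le1 // lerDr ltW.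
by rewrite lerD2l lerN2 ler_wpM2l // lef_pV2 ?posrE // lerDl.
Qed.

Section Decay.
Variables (R : realType) (alpha beta noise : R) (m : link_model).
Variables (a : ack_model) (nhat : nat).
Variables (X : metricType R) (I : finType) (L : I -> link X) (P : I -> R).
Variable Q : {set {set I}}.

Local Notation len v := (link_length (L v)).
Local Notation mu := (up_log 2 nhat).
Local Notation unacked := (unacked alpha beta noise m a L P).

Hypothesis alpha0 : 0 < alpha.
Hypothesis beta1 : 1 <= beta.
Hypothesis noise0 : 0 <= noise.
Hypothesis len_gt0 : forall v, 0 < len v.
Hypothesis P_gt0 : forall v, 0 < P v.
Hypothesis Pms : monotone_sub_linear alpha (fun v => len v) P.
Hypothesis schedQ : is_schedule alpha beta noise m L P Q.
Hypothesis tame : a = RealizedAcks -> dual_tame alpha beta noise L P m.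
Hypothesis mu0 : (0 < mu)%N.

Definition mean_unacked (t : nat) : R :=
  expectation alpha beta noise m a (backoff_algorithm R) nhat L P t
    (fun h => #|unacked h|%:R).

Lemma mean_unacked_le s t : (s <= t)%N -> mean_unacked t <= mean_unacked s.
Proof.
move=> /subnKC <-; elim: (t - s)%N => [|k IH]; first by rewrite addn0.
by rewrite addnS; apply: le_trans IH; exact: expectation_unackedS.
Qed.

Lemma mean_unacked_card t : mean_unacked t <= #|I|%:R.
Proof.
apply: (@le_trans _ _ (expectation alpha beta noise m a (backoff_algorithm R) nhat L P t
    (fun h => #|I|%:R * 1))).
  by apply: le_expectation => h _; rewrite mulr1 ler_nat max_card.
rewrite expectationZ /expectation; under eq_bigr do rewrite mulr1.
by rewrite execution_prob_total mulr1.
Qed.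

Lemma mean_unacked_drift j : backoff R nhat j * (load_const alpha * #|Q|%:R) <= 1 / 4 ->
  mean_unacked j.*2.+2 <= (1 - backoff R nhat j / 4) * mean_unacked j.*2.
Proof.
move=> qD; rewrite /mean_unacked !expectationS -expectationZ.
apply: le_expectation => h sh.
have jE : j = (size h)./2 by rewrite sh doubleK.
have [S' [sub card_S' loadS']] := schedule_light_subset alpha0 beta1 noise0 len_gt0
  P_gt0 Pms schedQ (unacked h) tame.
rewrite jE in qD *.
apply: (two_slots_drift _ _ _ _ _ _ sub card_S' loadS') => //.
- by move=> v; exact: (schedule_margin beta1 noise0 len_gt0 P_gt0 schedQ).
- by rewrite sh odd_double.
Qed.

(** The potential [(4 * mu + j) ^ mu * mean_unacked (2 * j)] does not increase once [j >= j0]. The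
    factor [4] in [backoff] cancels that of the drift, leaving [mu / y] with [y = 4 * mu + j], and
    the bound on [j0] makes [q * D <= 1 / 4]. *)
Lemma mean_unacked_decay (j0 i : nat) :
    (4 * (4 * mu))%:R * (load_const alpha * #|Q|%:R) <= j0%:R ->
  (4 * mu + (j0 + i))%:R ^+ mu * mean_unacked (j0 + i).*2
    <= (4 * mu + j0)%:R ^+ mu * #|I|%:R.
Proof.
move=> j0_ge; elim: i => [|i IH].
  by rewrite addn0 ler_wpM2l ?exprn_ge0 ?mean_unacked_card.
apply: le_trans IH; set j := (j0 + i)%N; rewrite addnS -/j doubleS.
set y := (4 * mu + j)%:R.
have y0 : 0 < y :> R by rewrite ltr0n addn_gt0 muln_gt0 mu0.
have qE : backoff R nhat j / 4 = mu%:R / y.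
  by rewrite /backoff -/y natrM mulrAC [4 * _]mulrC mulfK.
have drift : mean_unacked j.*2.+2 <= (1 - mu%:R / y) * mean_unacked j.*2.
  rewrite -qE; apply: mean_unacked_drift.
  rewrite /backoff -/y mulrAC ler_pdivrMr //.
  have : j0%:R <= y by rewrite ler_nat addnCA leq_addr.
  by move: j0_ge; rewrite natrM -mulrA; lra.
rewrite addnS -natr1 -/y.
apply: le_trans (ler_wpM2l _ drift) _; first by rewrite exprn_ge0 // addr_ge0 // ltW.
rewrite mulrA ler_wpM2r ?backoff_step //.
by apply: sumr_ge0 => x _; rewrite mulr_ge0 ?execution_prob_ge0.
Qed.

End Decay.

(** * Choice of constants and completion time *)

Definition ack_period (a : ack_model) : nat :=
  match a with RealizedAcks => 1 | CheapAcks k => k.+1 end.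

Lemma roundsE a s : rounds a s = (s %/ ack_period a)%N.
Proof. by case: a => //=; rewrite divn1. Qed.

(** Rounding the logarithm up costs at most a factor [2 <= n], hence [kappa.+1] in place of
    [kappa]. *)
Lemma up_log_ln (R : realType) (kappa n nhat : nat) : (1 < n)%N -> (nhat <= n ^ kappa)%N ->
  (up_log 2 nhat)%:R * ln 2 <= kappa.+1%:R * ln n%:R :> R.
Proof.
move=> n1 le_nhat.
have n0 : 0 < n%:R :> R by rewrite ltr0n ltnW.
have le1 : (2 ^ (up_log 2 nhat) <= n ^ kappa.+1)%N.
  have [small|big] := leqP nhat 1.
    have /eqP-> : up_log 2 nhat == 0%N by rewrite up_log_eq0 small orbT.
    by rewrite expn_gt0 ltnW.
  have := up_log_gtn (isT : (1 < 2)%N) big.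
  have : (0 < up_log 2 nhat)%N by rewrite up_log_gt0.
  case: (up_log 2 nhat) => // u _ /= lt.
  by rewrite !expnS leq_mul // (leq_trans (ltnW lt)).
have := ler_nat R (2 ^ up_log 2 nhat) (n ^ kappa.+1); rewrite le1 !natrX => le2.
by rewrite ![_%:R * ln _]mulr_natl -!lnXn // ler_ln ?posrE ?exprn_gt0.
Qed.

Lemma backoff_log_approximation (R : realType) (alpha beta noise : R) m a
    (pc : power_class R) :
    0 < alpha -> 1 <= beta -> 0 <= noise ->
    (forall (X : metricType R) (I : finType) (L : I -> link X) (P : I -> R),
       (forall v, 0 < link_length (L v)) -> (forall v, 0 < P v) ->
       pc I (fun v => link_length (L v)) P ->
       monotone_sub_linear alpha (fun v => link_length (L v)) P /\
       (a = RealizedAcks -> (forall v, 0 <= margin alpha beta noise L P v) ->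
        dual_tame alpha beta noise L P m)) ->
  log_approximation alpha beta noise (backoff_algorithm R) m a pc.
Proof.
move=> alpha0 beta1 noise0 pcP kappa c.
pose K0 := (Num.truncn (load_const alpha)).+1.
have K0_ge : load_const alpha <= K0%:R by rewrite ltW // truncnS_gt.
(* Chosen so that [2 ^ (B * mu) >= n ^ c.+1]; one of these factors [n] pays for the [n] links
   unacknowledged at the start. *)
pose B := (kappa * c.+1)%N.
pose D := (ack_period a * (2 * (2 ^ B * ((4 * K0 + 1) * 4))))%N.
exists (D%:R * kappa.+1%:R / ln 2).
move=> X n nhat L P T n1 [n_le nhat_le] len_gt0 P_gt0 pcLP [[Q schedQ cardQ] _].
have [Pms tame'] := pcP X _ L P len_gt0 P_gt0 pcLP.
have tame aE := tame' aE (schedule_margin beta1 noise0 len_gt0 P_gt0 schedQ).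
set mu := up_log 2 nhat.
(* An estimate of at most [1] would contradict [1 < n <= nhat ^ kappa]. *)
have mu0 : (0 < mu)%N.
  rewrite up_log_gt0 /= ltnNge; apply/negP => nhat1.
  have : (n <= 1)%N; last by rewrite leqNgt n1.
  rewrite (leq_trans n_le) // -(exp1n kappa).
  by case: (kappa) => // k; rewrite leq_exp2r.
have T0 : (0 < T)%N.
  rewrite -cardQ card_gt0; apply/set0Pn; exists (pblock Q (Ordinal (ltnW n1))).
  by rewrite pblock_mem // (schedule_cover schedQ).
have ln2 : 0 < ln 2 :> R by rewrite ln_gt0 // ltr1n.
(* From [j0] on the sending probability is low enough for the drift; at [J1] the quantity
   [4 * mu + j] has grown by the factor [2 ^ B], whose power [mu] is the required decay. *)
pose j0 := (4 * K0 * T * (4 * mu))%N.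
pose J1 := (2 ^ B * (4 * mu + j0))%N.
set s := Num.truncn _.
have s_ge : (ack_period a * (2 * J1) <= s)%N.
  have C0 : 0 <= D%:R * kappa.+1%:R / ln 2 * T%:R * ln n%:R :> R.
    by rewrite !mulr_ge0 ?invr_ge0 ?(ltW ln2) ?ln_ge0 ?ler1n ?(ltnW n1).
  rewrite /s truncn_ge_nat //.
  apply: (@le_trans _ _ (D * T * mu)%:R).
    (* [D] collects the period, the two slots per step and the constants of [J1]; [1 <= T] turns
       [4 * mu] into [4 * mu * T]. *)
    rewrite ler_nat (_ : D * T * mu = ack_period a *
      (2 * (2 ^ B * (4 * mu * T + 4 * K0 * T * (4 * mu)))))%N.
      by rewrite !leq_mul // leq_add // leq_pmulr.
    by rewrite /D; ring.
  have := up_log_ln R n1 nhat_le; rewrite -/mu => le_mu.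
  rewrite (_ : _ / _ * _ * _ = D%:R * T%:R * (kappa.+1%:R * ln n%:R) / ln 2).
    by rewrite ler_pdivlMr // 2!natrM -[leLHS]mulrA ler_wpM2l // mulr_ge0.
  by ring.
apply: le_trans (completion_prob_ge _ _ _ _ _ _ _ _ _ _).
rewrite lerD2l lerN2 roundsE.
set t := (s %/ ack_period a)%N.
have r0 : (0 < ack_period a)%N by case: (a).
have t_ge : (2 * J1 <= t)%N by rewrite leq_divRL // mulnC.
pose j := t./2.
have j_ge : (J1 <= j)%N by rewrite -(doubleK J1) half_leq // -mul2n.
have j0j : (j0 <= j)%N.
  by apply: leq_trans j_ge; rewrite /J1 -[leqLHS]mul1n leq_mul ?expn_gt0 ?leq_addl.
set E := expectation _ _ _ _ _ _ _ _ _ _ _.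
have EE : E <= mean_unacked alpha beta noise m a nhat L P j.*2.
  by apply: mean_unacked_le; rewrite -[leqRHS]odd_double_half leq_addl.
have E0 : 0 <= E by apply: sumr_ge0 => x _; rewrite mulr_ge0 ?execution_prob_ge0.
have := @mean_unacked_decay R alpha beta noise m a nhat X _ L P Q alpha0 beta1 noise0
  len_gt0 P_gt0 Pms schedQ tame mu0 j0 (j - j0).
rewrite cardQ subnKC // -/mu card_ord.
have hj0 : (4 * (4 * mu))%:R * (load_const alpha * T%:R) <= j0%:R.
  rewrite (_ : j0%:R = (4 * (4 * mu))%:R * (K0%:R * T%:R)); last by rewrite /j0 !natrM; ring.
  by rewrite ler_wpM2l // ler_wpM2r.
move=> /(_ hj0) decay.
have z0 : 0 < (4 * mu + j0)%:R :> R by rewrite ltr0n addn_gt0 muln_gt0 mu0.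
have powE : (2 ^ (B * mu))%:R * E <= n%:R.
  have : (2 ^ B)%:R ^+ mu * (4 * mu + j0)%:R ^+ mu * E <= (4 * mu + j0)%:R ^+ mu * n%:R.
    apply: le_trans decay; rewrite ler_pM ?mulr_ge0 ?exprn_ge0 //.
    rewrite -exprMn lerXn2r ?nnegrE ?mulr_ge0 // -natrM ler_nat.
    by apply: leq_trans j_ge _; rewrite leq_addl.
  rewrite mulrAC mulrC ler_pM2l ?exprn_gt0 //.
  by rewrite -natrX -expnM.
have n_pow : (n ^ c.+1 <= 2 ^ (B * mu))%N.
  apply: (@leq_trans ((nhat ^ kappa) ^ c.+1)); first by rewrite leq_exp2r.
  rewrite -expnM -/B mulnC expnM.
  by case: (B) => [|B']; rewrite ?expn0 // leq_exp2r // up_logP.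
have n0 : 0 < n%:R :> R by rewrite ltr0n ltnW.
rewrite -[leRHS]mul1r ler_pdivlMr ?exprn_gt0 //.
rewrite -(ler_pM2r n0) mul1r; apply: le_trans powE.
rewrite -mulrA -exprSr mulrC ler_wpM2r // -natrX ler_nat //.
Qed.

Theorem theorem1 (R : realType) (alpha beta noise : R) :
  0 < alpha -> 1 <= beta -> 0 <= noise ->
  (exists A : ack_only_algorithm R,
     [/\ log_approximation alpha beta noise A
           Unidirectional RealizedAcks (@uniform_power R),
         log_approximation alpha beta noise A
           Unidirectional RealizedAcks (linear_power alpha)
       & log_approximation alpha beta noise A
           Bidirectional RealizedAcks (monotone_sub_linear alpha)]) /\
  (exists A : ack_only_algorithm R,
     forall k : nat,
       log_approximation alpha beta noise A
         Unidirectional (CheapAcks k) (monotone_sub_linear alpha)).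
Proof.
move=> alpha0 beta1 noise0; split; exists (backoff_algorithm R); first split.
- apply: backoff_log_approximation => // X I L P len_gt0 P_gt0 unif.
  by split=> [|_ g0]; [exact: uniform_monotone_sub_linear|exact: uniform_tame].
- apply: backoff_log_approximation => // X I L P len_gt0 P_gt0 lin.
  by split=> [|_ g0]; [exact: linear_monotone_sub_linear|exact: linear_tame].
- apply: backoff_log_approximation => // X I L P len_gt0 P_gt0 Pms.
  by split=> // _ _; exact: bidirectional_tame.
- by move=> k; apply: backoff_log_approximation.
Qed.
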